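(* Let $d$ be fixed, $0<c<1$, and $\varepsilon=\varepsilon_n>0$ be either a fixed constant or a sequence with $\varepsilon_n\to 0$ and $\varepsilon_n\log n\to\infty$. Then the proportion of graphs in $\mathcal{G}_{d,c}(n)$ having more than $\varepsilon n$ bad nodes tends to $0$ as $n\to\infty$.
   Context: $T_{\max}=\binom{d}{2}\frac{n}{3}$. $\mathcal{G}_{d,c}(n)$ is the set of $d$-regular graphs on $n$ labeled nodes containing at least $c\cdot T_{\max}$ triangles. A node is bad if it is incident to at least one triangle but is not contained in any clique on $d+1$ nodes. *)

(* Defs.v *)
From HB Require Import structures.
From mathcomp Require Import all_boot all_order all_algebra.
From mathcomp Require Import all_classical all_reals all_analysis.
Set Implicit Arguments. Unset Strict Implicit. Unset Printing Implicit Defensive.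
Import Order.TTheory GRing.Theory Num.Theory.
Local Open Scope ring_scope.

(* A labeled graph on n nodes 'I_n, given by its adjacency sets. *)
Definition graph (n : nat) := {ffun 'I_n -> {set 'I_n}}.

Definition simple_graph n (g : graph n) : bool :=
  [forall x, x \notin g x] && [forall x, forall y, (y \in g x) == (x \in g y)].

Definition regular n (d : nat) (g : graph n) : bool :=
  [forall x, #|g x| == d]%N.

Definition is_clique n (g : graph n) (K : {set 'I_n}) : bool :=
  [forall x in K, forall y in K, (x != y) ==> (y \in g x)].

Definition triangles n (g : graph n) : {set {set 'I_n}} :=
  [set t : {set 'I_n} | (#|t| == 3)%N && is_clique g t].

Definition bad_node n (d : nat) (g : graph n) (v : 'I_n) : bool :=
  [exists t in triangles g, v \in t] &&
  ~~ [exists K : {set 'I_n}, [&& v \in K, #|K| == d.+1 & is_clique g K]].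

Definition bad_nodes n d (g : graph n) : {set 'I_n} := [set v | bad_node d g v].

Definition Tmax (R : realType) (d n : nat) : R := 'C(d, 2)%:R * n%:R / 3%:R.

Definition Gdc (R : realType) (d : nat) (c : R) (n : nat) : {set graph n} :=
  [set g : graph n | [&& simple_graph g, regular d g &
     c * Tmax R d n <= #|triangles g|%:R]].

(* proportion of graphs in G_{d,c}(n) with more than eps*n bad nodes
   (MathComp convention x / 0 = 0 if G_{d,c}(n) is empty) *)
Definition bad_proportion (R : realType) (d : nat) (c eps : R) (n : nat) : R :=
  #|[set g in Gdc d c n | eps * n%:R < #|bad_nodes d g|%:R]|%:R / #|Gdc d c n|%:R.

(* Main.v *)
(* Reveal the vertices of a d-regular graph in a uniformly random order; when u
   is revealed, disclose also all adjacencies inside its neighbourhood, which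
   costs only O(1) bits.  An edge xy with t common neighbours then has to be
   paid for, at the price of log n, only if no common neighbour precedes both x
   and y, which has probability 2/(t+2).  Since t <= d-1, 2/(t+2) is at most
   1 - t/(d+1), with a gap bounded below when 0 < t < d-1, and each bad node has
   an incident edge of the latter kind.  Summing over the edges, a graph with T
   triangles and b bad nodes costs at most dn/2 - 3T/(d+1) - delta b units of
   log n, so Jensen's inequality bounds the number of graphs with T >= c T_max
   and b > eps n by exp((dn/2 - 3c T_max/(d+1) - delta eps n) log n + O(n)).
   Conversely, about cn/(d+1) disjoint cliques K_{d+1} together with a d-regular
   bipartite graph on the other vertices already give
   exp((dn/2 - 3c T_max/(d+1)) log n - O(n)) graphs with at least c T_max
   triangles, and eps log n tends to infinity. *)
Require Import Defs.
From HB Require Import structures.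
From mathcomp Require Import all_boot all_order all_algebra all_fingroup.
From mathcomp Require Import zify.
Set Implicit Arguments. Unset Strict Implicit. Unset Printing Implicit Defensive.

(** * Codegrees, triangles and bad nodes *)

(** By symmetry each element of [B] comes first in equally many orders, and every order has exactly
    one first element of [B]. *)
Lemma card_perm_argmin n (B : {set 'I_n}) x : x \in B ->
  #|[set s : 'S_n | [forall y in B, s x <= s y]]| * #|B| = n`!.
Proof.
move=> xB; pose N y := [set s : 'S_n | [forall z in B, s y <= s z]].
(* Composing with [tperm x y] exchanges the orders minimal at x and at y. *)
have NE y : y \in B -> #|N y| = #|N x|.
  move=> yB; rewrite -(card_imset _ (mulgI (tperm x y))) /N.
  apply: eq_card => s; rewrite inE; apply/imsetP/forall_inP => [[r]|h].
    rewrite inE => /forall_inP h -> z zB; rewrite !permM tpermL.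
    by apply: h; case: tpermP.
  exists (tperm x y * s)%g; last by rewrite mulgA tperm2 mul1g.
  rewrite inE; apply/forall_inP => z zB; rewrite !permM tpermR.
  by apply: h; case: tpermP.
rewrite -/(N x) mulnC -sum_nat_const.
rewrite (eq_bigr (fun y => #|N y|)) => [|y yB]; last by rewrite NE.
rewrite -card_Sn -[RHS]sum1_card.
under eq_bigr => y _ do rewrite -sum1_card big_mkcond.
rewrite exchange_big; apply: eq_bigr => s _.
case: (arg_minnP (fun y => s y : nat) xB) => y0 y0B y0min.
rewrite (bigD1 y0) //= big1 ?addn0 => [|y /andP[yB yy0]].
  by rewrite inE ifT //; apply/forall_inP.
rewrite inE ifF //; apply/negP => /forall_inP /(_ _ y0B) le.
have /val_inj/perm_inj E : val (s y) = val (s y0).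
  by apply/eqP; rewrite eqn_leq le y0min.
by rewrite E eqxx in yy0.
Qed.

Lemma cards3 (T : finType) (x y z : T) :
  (#|[set x; y; z]| == 3) = uniq [:: x; y; z].
Proof.
rewrite (@eq_card _ _ (mem [:: x; y; z])) => [|u]; last by rewrite !inE orbA.
by apply/eqP/card_uniqP.
Qed.

Definition codeg n (g : graph n) x y := #|g x :&: g y|.

Section SimpleGraph.
Variables (n : nat) (g : graph n).
Hypothesis sg : simple_graph g.

Lemma simple_irr x : x \notin g x.
Proof. by case/andP: sg => /forallP. Qed.

Lemma simple_sym x y : (y \in g x) = (x \in g y).
Proof. by case/andP: sg => _ /forallP/(_ x)/forallP/(_ y)/eqP. Qed.

Lemma is_clique3 x y z :
  (#|[set x; y; z]| == 3) && is_clique g [set x; y; z] =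
  [&& y \in g x, z \in g x & z \in g y].
Proof.
rewrite cards3 /= !inE negb_or andbT.
apply/andP/and3P => [[/andP[/andP[xy xz] yz] /forall_inP K]|[yx zx zy]].
  have {}K u v : u \in [set x; y; z] -> v \in [set x; y; z] -> u != v -> v \in g u.
    by move=> uS vS uv; have /forall_inP/(_ _ vS)/implyP := K _ uS; apply.
  by split; apply: K => //; rewrite !inE eqxx ?orbT.
have nbr_neq u v : v \in g u -> u != v.
  by apply: contraTneq => ->; exact: simple_irr.
split; first by rewrite !nbr_neq.
apply/forall_inP => u; rewrite !inE => uS; apply/forall_inP => v; rewrite !inE => vS.
apply/implyP => uv; move: uS vS uv.
by case/orP=> [/orP[]|] /eqP-> /orP[/orP[]|] /eqP->; rewrite ?eqxx //;
  rewrite // simple_sym.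
Qed.

(** Both sides count ordered triples spanning a triangle; each triangle has six orderings. *)
Lemma sum_codeg_triangles :
  \sum_x \sum_(y in g x) codeg g x y = 6 * #|triangles g|.
Proof.
have -> : 6 * #|triangles g| = \sum_(t in triangles g)
    \sum_x \sum_y \sum_z ([set x; y; z] == t).
  rewrite mulnC -sum_nat_const; apply: eq_bigr => t.
  rewrite inE => /andP[/eqP t3 _].
  have E x y z : ([set x; y; z] == t) = [&& x \in t, y \in t :\ x & z \in t :\ x :\ y].
    rewrite !inE; apply/eqP/idP => [tE|/and3P[xt /andP[yx yt] /and3P[zy zx zt]]].
      move/eqP: t3; rewrite -tE cards3 /= !inE !eqxx !orbT !andbT negb_or.
      by rewrite ![_ == x]eq_sym ![_ == y]eq_sym => /andP[/andP[-> ->] ->].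
    apply/eqP; rewrite eqEcard; apply/andP; split.
      by apply/subsetP => u; rewrite !inE => /orP[/orP[]|] /eqP->.
    rewrite t3 eq_leq //; apply/esym/eqP; rewrite cards3 /= !inE negb_or.
    by rewrite eq_sym yx eq_sym zx eq_sym zy.
  rewrite (bigID (mem t)) /= [X in _ = _ + X]big1 ?addn0 => [|x xt]; last first.
    by apply: big1 => y _; apply: big1 => z _; rewrite E (negbTE xt).
  rewrite (eq_bigr (fun=> 2)) ?sum_nat_const ?t3 // => x xt.
  rewrite (bigID (mem (t :\ x))) /= [X in _ + X]big1 ?addn0 => [|y yt]; last first.
    by apply: big1 => z _; rewrite E (negbTE yt) andbF.
  have c2 : #|t :\ x| = 2 by move: t3; rewrite (cardsD1 x) xt => -[].
  rewrite (eq_bigr (fun=> 1)) ?sum_nat_const ?c2 // => y yt.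
  under eq_bigr => z _ do rewrite E xt yt /=.
  have: #|t :\ x :\ y| = 1 by move: c2; rewrite (cardsD1 y) yt => -[].
  by rewrite -sum1_card big_mkcond.
under eq_bigr => x _ do rewrite big_mkcond.
rewrite [RHS]exchange_big; apply: eq_bigr => x _ /=.
rewrite [RHS]exchange_big; apply: eq_bigr => y _ /=.
rewrite [RHS]exchange_big /codeg -sum1_card big_mkcond /=.
rewrite (_ : (if _ then _ else _) = \sum_z (if y \in g x then
    (if z \in g x :&: g y then 1 else 0) else 0)); last first.
  by case: ifP => // _; rewrite big1.
apply: eq_bigr => z _.
rewrite (_ : (if _ then _ else _) = ([set x; y; z] \in triangles g) :> nat); last first.
  rewrite [_ \in triangles g]inE is_clique3 !inE.
  by case: (y \in g x) => //=; case: ifP => ->.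
rewrite big_mkcond /= (bigD1 [set x; y; z]) //= eqxx big1 ?addn0.
  by case: (_ \in _).
by move=> t; rewrite eq_sym => /negbTE->; case: ifP.
Qed.

Section Regular.
Variable d : nat.
Hypothesis rg : regular d g.

Lemma regular_card x : #|g x| = d.
Proof. by apply/eqP; move/forallP: rg. Qed.

Lemma codeg_lt x y : y \in g x -> codeg g x y < d.
Proof.
move=> yx; rewrite -(regular_card x) (cardsD1 y (g x)) yx add1n ltnS.
apply: subset_leq_card; apply/subsetP => z; rewrite !inE => /andP[-> zy].
by rewrite andbT; apply: contraTneq zy => ->; apply: simple_irr.
Qed.

(** The common neighbours lie in [g x :\ y], of size d - 1, so codegree d - 1 leaves nothing out. *)
Lemma codeg_maxP x y : y \in g x -> d <= (codeg g x y).+1 ->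
  forall z, z \in g x -> z != y -> z \in g y.
Proof.
move=> yx le z zx zy.
have sub : g x :&: g y \subset g x :\ y.
  apply/subsetP => u; rewrite !inE => /andP[-> uy].
  by rewrite andbT; apply: contraTneq uy => ->; apply: simple_irr.
have /setP/(_ z) : g x :&: g y = g x :\ y.
  apply/eqP; rewrite eqEcard sub /=.
  by move: le; rewrite -(regular_card x) (cardsD1 y (g x)) yx.
by rewrite !inE zy zx.
Qed.

(** If all codegrees at [v] were 0 or d - 1, a triangle edge vy would have codegree d - 1, making
    [y] adjacent to all other neighbours of [v]; then every edge at [v] has positive, hence maximal,
    codegree, and [v |: g v] is a clique. *)
Lemma bad_node_edge v : bad_node d g v ->
  exists2 y, y \in g v & 0 < codeg g v y < d.-1.
Proof.
case/andP => /exists_inP[t /[!inE] /andP[/eqP t3 tK] vt] noK.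
pose P := [pred y | (y \in g v) && (0 < codeg g v y < d.-1)].
case: (pickP P) => [y /andP[]|none]; first by exists y.
case/negP: noK; apply/existsP; exists (v |: g v).
have full y : y \in g v -> 0 < codeg g v y -> d <= (codeg g v y).+1.
  by move=> yv c0; move: (none y); rewrite /= yv c0 /=; lia.
have [y yv c0] : exists2 y, y \in g v & 0 < codeg g v y.
  have /card_gt0P[y yt] : 0 < #|t :\ v|.
    by move: t3; rewrite (cardsD1 v) vt add1n => -[->].
  have /card_gt0P[z zt] : 0 < #|t :\ v :\ y|.
    by move: t3; rewrite (cardsD1 v) vt (cardsD1 y (t :\ v)) yt !add1n => -[->].
  move: yt zt; rewrite !inE => /andP[yv yt] /and3P[zy zv zt].
  have K a b : a \in t -> b \in t -> b != a -> b \in g a.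
    move=> at_ bt ba; have /forall_inP/(_ _ bt)/implyP := forall_inP tK _ at_.
    by rewrite eq_sym; apply.
  exists y; first exact: K.
  by apply/card_gt0P; exists z; rewrite !inE !K.
have cl z : z \in g v -> d <= (codeg g v z).+1.
  move=> zv; have [->|zy] := eqVneq z y; first exact: full.
  apply: (full) => //; apply/card_gt0P; exists y; rewrite inE yv /= -simple_sym.
  exact: (codeg_maxP yv (full _ yv c0)).
rewrite !inE eqxx cardsU1 simple_irr regular_card add1n eqxx /=.
apply/forall_inP => a aS; apply/forall_inP => b bS; apply/implyP => ab.
move: aS bS; rewrite !inE => /orP[/eqP av|av] /orP[/eqP bv|bv].
- by rewrite av bv eqxx in ab.
- by rewrite av.
- by rewrite simple_sym bv.
- by apply: (codeg_maxP av (cl _ av)) => //; rewrite eq_sym.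
Qed.

Lemma regular_even : ~~ odd (d * n).
Proof.
have -> : d * n = \sum_(p : 'I_n * 'I_n) (p.2 \in g p.1).
  rewrite -(pair_bigA _ (fun x y => y \in g x : nat)) /=.
  under eq_bigr => x _ do rewrite -big_mkcond sum1_card regular_card.
  by rewrite sum_nat_const card_ord mulnC.
rewrite (bigID (fun p : 'I_n * 'I_n => p.1 < p.2)) /=.
set A := \sum_(_ | _) _; set B := \sum_(_ | _) _.
suff -> : B = A by rewrite addnn odd_double.
rewrite /B (bigID (fun p : 'I_n * 'I_n => p.1 == p.2)) /=.
rewrite big1 ?add0n => [|[x y] /andP[_ /= /eqP->]]; last first.
  by rewrite (negbTE (simple_irr y)).
rewrite (reindex_inj (can_inj (@swap_pairK _ _))) /=.
rewrite /A; apply: eq_big => [[x y]|[x y] _] /=; last by rewrite simple_sym.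
by rewrite -leqNgt ltn_neqAle andbC eq_sym.
Qed.

End Regular.
End SimpleGraph.

(** * Many regular graphs with many triangles *)

Section Construction.
Variables d k q : nat.

(* The vertices (j, a) : 'I_d.+1 * 'I_k carry k cliques, given by bijections from
   each of the d last layers j to layer 0.  The vertices (b, (i, a)) carry a
   bipartite graph with sides b, each divided into d blocks i of size q: a
   bijection from every left block to every right block makes it d-regular, and
   the edges of different bijections are automatically distinct. *)
Definition clique_perms := {ffun 'I_d -> 'S_k}.
Definition bip_perms := {ffun 'I_d * 'I_d -> 'S_q}.
Definition vertex : finType := ('I_d.+1 * 'I_k + bool * ('I_d * 'I_q))%type.

Definition col (t : clique_perms) (j : 'I_d.+1) : 'S_k :=
  if unlift ord0 j is Some i then t i else 1%g.

Definition adj (tp : clique_perms * bip_perms) : rel vertex := fun u v =>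
  match u, v with
  | inl (j, a), inl (j', a') => (j != j') && (col tp.1 j a == col tp.1 j' a')
  | inr (false, (i, a)), inr (true, (i', a')) => tp.2 (i, i') a == a'
  | inr (true, (i, a)), inr (false, (i', a')) => tp.2 (i', i) a' == a
  | _, _ => false
  end.

Lemma adj_irr tp u : ~~ adj tp u u.
Proof. by case: u => [[j a]|[[] [i a]]] //=; rewrite eqxx. Qed.

Lemma adj_sym tp u v : adj tp u v = adj tp v u.
Proof.
case: u v => [[j a]|[[] [i a]]] [[j' a']|[[] [i' a']]] //=.
by rewrite [j == _]eq_sym [col tp.1 j a == _]eq_sym.
Qed.

(** Layer 0 has the identity colouring, so the neighbour there of a vertex in layer [lift ord0 i]
    reads off [t i]. *)
Lemma adj_inj tp tp' : adj tp =2 adj tp' -> tp = tp'.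
Proof.
move: tp tp' => [t p] [t' p'] E; congr pair; apply/ffunP.
  move=> i; apply/permP => a.
  have := E (inl (lift ord0 i, a)) (inl (ord0, t i a)).
  rewrite /= /col !liftK !unlift_none !perm1 eqxx.
  by move/esym/eqP.
move=> [i i']; apply/permP => a.
have := E (inr (false, (i, a))) (inr (true, (i', p (i, i') a))).
by rewrite /= eqxx => /esym/eqP.
Qed.

(** The vertex of layer [j] lying in the same clique as [u]. *)
Definition mate (t : clique_perms) (u : 'I_d.+1 * 'I_k) (j : 'I_d.+1) : vertex :=
  inl (j, ((col t j)^-1)%g (col t u.1 u.2)).

Lemma adj_cliqueE tp j a :
  [set v | adj tp (inl (j, a)) v] = mate tp.1 (j, a) @: [set~ j].
Proof.
apply/setP => v; rewrite inE; apply/idP/imsetP.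
  case: v => [[j' a']|[[] [i a']]] //= /andP[jj' /eqP E].
  exists j'; first by rewrite !inE eq_sym.
  by rewrite /mate /= E permK.
by move=> [j' /[!inE] jj' ->] /=; rewrite eq_sym jj' permKV eqxx.
Qed.

Lemma mate_inj t u : injective (mate t u).
Proof. by move=> j j' []. Qed.

Lemma adj_degree tp u : #|[set v | adj tp u v]| = d.
Proof.
case: u => [[j a]|[b [i a]]].
  by rewrite adj_cliqueE card_imset ?cardsC1 ?card_ord //; apply: mate_inj.
pose f (i' : 'I_d) : vertex := inr (~~ b, (i',
  if b then ((tp.2 (i', i))^-1)%g a else tp.2 (i, i') a)).
rewrite (_ : [set v | _] = f @: [set: 'I_d]).
  by rewrite card_imset ?cardsT ?card_ord // => x y [].
apply/setP => v; rewrite inE; apply/idP/imsetP.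
  rewrite /f {f}; case: b; case: v => [[j a']|[[] [i' a']]] //= /eqP E;
    exists i'; rewrite ?inE //.
    by rewrite -E permK.
  by rewrite E.
by case=> i' _ ->; rewrite /f; case: (b) => //=; rewrite permKV.
Qed.

Lemma adj_codeg_clique tp j a v : adj tp (inl (j, a)) v ->
  d.-1 <= #|[set w | adj tp (inl (j, a)) w] :&: [set w | adj tp v w]|.
Proof.
case: v => [[j' a']|[[] [i a']]] // jv; move: (jv) => /= /andP[jj' /eqP E].
have -> : d.-1 = #|[set~ j] :\ j'|.
  have := cardsD1 j' [set~ j]; rewrite cardsC1 card_ord !inE eq_sym jj' /=; lia.
rewrite -(card_imset _ (@mate_inj tp.1 (j, a))).
apply: subset_leq_card; rewrite !adj_cliqueE subsetI.
rewrite (imsetS _ (subsetDl _ _)) /=.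
have -> : mate tp.1 (j, a) = mate tp.1 (j', a') by rewrite /mate /= E.
by apply: imsetS; apply/subsetP => x; rewrite !inE => /andP[].
Qed.

Variable n : nat.
Hypothesis nE : #|{: vertex}| = n.

Definition to_vertex (x : 'I_n) : vertex := enum_val (cast_ord (esym nE) x).

Lemma to_vertex_bij : bijective to_vertex.
Proof.
exists (fun v => cast_ord nE (enum_rank v)) => [x|v]; rewrite /to_vertex.
  by rewrite enum_valK cast_ordKV.
by rewrite cast_ordK enum_rankK.
Qed.

Definition adj_graph tp : graph n :=
  [ffun x => [set y | adj tp (to_vertex x) (to_vertex y)]].

Lemma adj_graph_inj : injective adj_graph.
Proof.
have [h hK Kh] := to_vertex_bij; move=> tp tp' E; apply: adj_inj.
move=> u v.
have := congr1 (fun g : graph n => h v \in g (h u)) E.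
by rewrite /= !ffunE !inE !Kh.
Qed.

Lemma card_to_vertex (P : pred vertex) :
  #|[set x | P (to_vertex x)]| = #|[set v | P v]|.
Proof.
have [h hK Kh] := to_vertex_bij.
rewrite -(card_imset _ (can_inj hK)); apply: eq_card => v; rewrite inE.
apply/imsetP/idP => [[x /[!inE] Px ->] //|Pv].
by exists (h v); rewrite ?inE Kh.
Qed.

Lemma adj_graph_simple tp : simple_graph (adj_graph tp).
Proof.
apply/andP; split; apply/forallP => x; first by rewrite ffunE inE adj_irr.
by apply/forallP => y; rewrite !ffunE !inE adj_sym.
Qed.

Lemma adj_graph_regular tp : regular d (adj_graph tp).
Proof.
by apply/forallP => x; rewrite ffunE (card_to_vertex (adj tp _)) adj_degree.
Qed.

Lemma adj_graph_triangles tp :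
  k * d.+1 * d * d.-1 <= 6 * #|triangles (adj_graph tp)|.
Proof.
rewrite -sum_codeg_triangles ?adj_graph_simple //.
pose C := [set x : 'I_n | if to_vertex x is inl _ then true else false].
have cC : #|C| = k * d.+1.
  rewrite (card_to_vertex (fun v => if v is inl _ then true else false)).
  transitivity #|@inl ('I_d.+1 * 'I_k) (bool * ('I_d * 'I_q)) @: setT|.
    apply: eq_card => -[u|u]; rewrite !inE; apply/esym/imsetP; first by exists u.
    by case.
  by rewrite card_imset ?cardsT ?card_prod ?card_ord 1?mulnC // => x y [].
rewrite -cC -mulnA -sum_nat_const [leqRHS](bigID (mem C)) /=.
apply: leq_trans (leq_addr _ _); apply: leq_sum => x.
rewrite inE; case E: (to_vertex x) => [[j a]|//] _.
rewrite -{1}(regular_card (adj_graph_regular tp) x) -sum_nat_const.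
apply: leq_sum => y; rewrite ffunE inE E => yx.
apply: leq_trans (adj_codeg_clique yx) _; rewrite eq_leq //.
transitivity #|[set w | adj tp (inl (j, a)) w && adj tp (to_vertex y) w]|.
  by apply: eq_card => w; rewrite !inE.
rewrite -(card_to_vertex (fun w => adj tp (inl (j, a)) w && adj tp _ w)).
by apply: eq_card => z; rewrite !ffunE !inE E.
Qed.

End Construction.

Lemma card_regular_many_triangles d k q n : k * d.+1 + 2 * d * q = n ->
  k`! ^ d * q`! ^ (d * d) <= #|[set g : graph n | [&& simple_graph g, regular d g
    & k * d.+1 * d * d.-1 <= 6 * #|triangles g|]]|.
Proof.
move=> nE; have VE : #|{: vertex d k q}| = n.
  by rewrite -nE card_sum !card_prod card_bool !card_ord mulnC mulnA.
have <- : #|{: clique_perms d k * bip_perms d q}| = k`! ^ d * q`! ^ (d * d).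
  by rewrite card_prod !card_ffun !card_Sn card_prod !card_ord.
rewrite -cardsT -(card_imset _ (adj_graph_inj (nE := VE))).
apply: subset_leq_card; apply/subsetP => g /imsetP[tp _ ->].
by rewrite inE adj_graph_simple adj_graph_regular adj_graph_triangles.
Qed.

(* Since dn is even, n(d+1)^2 = n mod 2d, so k = n(d+1) mod 2d is a solution. *)
Lemma clique_bipartite_decomposition d n k0 : 0 < d -> ~~ odd (d * n) ->
  (k0 + 2 * d) * d.+1 <= n ->
  exists k q, [/\ k0 <= k, k <= k0 + 2 * d & k * d.+1 + 2 * d * q = n].
Proof.
(* The least k >= k0 congruent to n(d+1) modulo 2d; (2d-1)k0 stands for -k0 in [nat]. *)
move=> d0 ev le; pose k := k0 + (n * d.+1 + (2 * d).-1 * k0) %% (2 * d).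
have k2 : k <= k0 + 2 * d by rewrite leq_add2l ltnW // ltn_mod muln_gt0.
have kn : k * d.+1 <= n by apply: leq_trans le; rewrite leq_mul2r k2 orbT.
have : k * d.+1 = n %[mod 2 * d].
  have kE : k = n * d.+1 %[mod 2 * d].
    rewrite /k modnDmr addnCA -mulSn prednK ?muln_gt0 //.
    by rewrite addnC mulnC modnMDl.
  rewrite -modnMml kE modnMml.
  have -> : n * d.+1 * d.+1 = ((d * n)./2 + n) * (2 * d) + n.
    have := even_halfK ev; rewrite -muln2; nia.
  by rewrite modnMDl.
move/eqP; rewrite eq_sym eqn_mod_dvd // => /dvdnP[q qE].
exists k, q; split=> //; first exact: leq_addr.
by rewrite [2 * d * q]mulnC -qE subnKC.
Qed.

From mathcomp Require Import all_classical all_reals all_analysis.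
From mathcomp Require Import ring lra.
Import Order.TTheory GRing.Theory Num.Theory.
Local Open Scope ring_scope.

(** * The encoding of a graph along a vertex order *)

(* The edges (x, y), with x before y in the order s, not revealed by a common
   neighbour preceding x. *)
Definition paid n (s : 'S_n) (g : graph n) : {set 'I_n * 'I_n} :=
  [set p | (p.2 \in g p.1) &&
    [forall z in p.1 |: (p.2 |: g p.1 :&: g p.2), (s p.1 <= s z)%N]].

(* The adjacencies inside the neighbourhood of u, read through positions in the
   list [enum (g u)]; the default value of [nth] is irrelevant when g is d-regular. *)
Definition local_code n d (g : graph n) : {ffun 'I_n -> {set 'I_d * 'I_d}} :=
  [ffun u => [set p : 'I_d * 'I_d |
    nth u (enum (g u)) p.2 \in g (nth u (enum (g u)) p.1)]].

Definition regular_graphs n d : {set graph n} :=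
  [set g | simple_graph g && regular d g].

(** Since [g u = g' u], positions in [enum (g u)] denote the same vertices in both graphs. *)
Lemma local_codeP n d (g g' : graph n) u x y : simple_graph g -> regular d g ->
  local_code d g = local_code d g' -> g u = g' u ->
  x \in g u -> y \in g u -> y \in g x -> y \in g' x.
Proof.
move=> sg rg E Eu xu yu yx.
have ix v : v \in g u -> (index v (enum (g u)) < d)%N.
  by move=> vu; rewrite -(regular_card rg u) cardE index_mem mem_enum.
move/ffunP/(_ u)/setP/(_ (Ordinal (ix _ xu), Ordinal (ix _ yu))): E.
by rewrite !ffunE !inE /= -Eu !nth_index ?mem_enum // yx => <-.
Qed.

(** Induction along the order: once the neighbourhoods of the predecessors of x agree, symmetry
    gives the earlier neighbours of x, and a later one is either paid or revealed by the local code
    of a predecessor. *)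
Lemma code_inj n d (s : 'S_n) :
  {in regular_graphs n d &, injective (fun g => (paid s g, local_code d g))}.
Proof.
move=> g g' /[!inE] /andP[sg rg] /andP[sg' rg'] [EP EL].
have sub (h h' : graph n) x : simple_graph h -> simple_graph h' ->
    regular d h -> paid s h = paid s h' -> local_code d h = local_code d h' ->
    (forall u, (s u < s x)%N -> h u = h' u) -> h x \subset h' x.
  move=> sh sh' rh HP HL IH; apply/fintype.subsetP => y yx.
  have yNx : y != x by apply: contraTneq yx => ->; apply: simple_irr.
  have [lt|lt|/val_inj/perm_inj E] := ltngtP (s y) (s x).
  - by rewrite (simple_sym sh') -IH // (simple_sym sh).
  - have [pd|npd] := boolP ((x, y) \in paid s h).
      by move: pd; rewrite HP inE => /andP[].
    move: npd; rewrite inE /= yx /= => /forall_inPn[u].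
    rewrite !inE -ltnNge => /orP[/eqP->|/orP[/eqP->|/andP[ux uy]]] su.
    - by rewrite ltnn in su.
    - by rewrite ltnNge (ltnW lt) in su.
    by apply: (local_codeP sh rh HL (IH _ su)); rewrite // simple_sym.
  - by rewrite E eqxx in yNx.
have eqx m x : (s x < m)%N -> g x = g' x.
  elim: m x => // m IH x sx; apply/eqP; rewrite finset.eqEsubset.
  have IHx u : (s u < s x)%N -> g u = g' u.
    by move=> su; apply: IH; apply: leq_trans su _.
  by rewrite !sub // => u su; rewrite IHx.
by apply/ffunP => x; apply: (eqx (s x).+1).
Qed.

(** * Exponential moments of the number of paid edges *)

Section Weights.
Variable R : realType.
Implicit Types (n d : nat).

Lemma sum_expr_card (T : finType) (a : R) :
  \sum_(A : {set T}) a ^+ #|A| = (1 + a) ^+ #|T|.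
Proof.
rewrite -prodr_const; under [RHS]eq_bigr => i _ do rewrite addrC.
rewrite (bigA_distr (I := T) _ _ (fun=> a) (fun=> 1)); apply: eq_bigr => A _.
by rewrite -big_mkcond prodr_const.
Qed.

(** By injectivity the sum extends to all codes: a weighted set of pairs, and d * d bits for each
    vertex. *)
Lemma sum_paid_le n d (s : 'S_n) (a : R) : 0 <= a ->
  \sum_(g in regular_graphs n d) a ^+ #|paid s g|
    <= (1 + a) ^+ (n * n) * 2 ^+ (d * d * n).
Proof.
move=> a0; pose h g := (paid s g, local_code d g).
rewrite -(big_imset (fun p : {set 'I_n * 'I_n} * {ffun 'I_n -> {set 'I_d * 'I_d}} =>
  a ^+ #|p.1|) (@code_inj n d s)) /=.
have -> : (1 + a) ^+ (n * n) * 2 ^+ (d * d * n) =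
   \sum_(p : {set 'I_n * 'I_n} * {ffun 'I_n -> {set 'I_d * 'I_d}}) a ^+ #|p.1|.
  rewrite -(pair_bigA _ (fun (P : {set 'I_n * 'I_n}) _ => a ^+ #|P|)) /=.
  under eq_bigr => P _ do rewrite sumr_const -mulr_natr.
  rewrite -mulr_suml sum_expr_card card_prod !card_ord; congr (_ * _).
  rewrite card_ffun -[#|{: {set _}}|]cardsT -powersetT card_powerset cardsT.
  rewrite card_prod !card_ord.
  by rewrite natrX natrX -exprM.
rewrite [leRHS](bigID (mem [set h g | g in regular_graphs n d])) /=.
by rewrite lerDl sumr_ge0 // => p _; apply: exprn_ge0.
Qed.

(* Jensen's inequality, from the tangent line of exp at the mean. *)
Lemma expR_mean_le (T : finType) (f : T -> R) : (0 < #|T|)%N ->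
  #|T|%:R * expR ((\sum_t f t) / #|T|%:R) <= \sum_t expR (f t).
Proof.
move=> T0; set m := _ / _.
have T0' : #|T|%:R != 0 :> R by rewrite pnatr_eq0 -lt0n.
have -> : #|T|%:R * expR m = \sum_t expR m * (1 + (f t - m)).
  rewrite -mulr_sumr big_split sumrB /= !sumr_const -[X in _ - X]mulr_natr /m.
  by rewrite divfK // subrr addr0 mulrC.
apply: ler_sum => t _; rewrite -[X in _ <= expR X](subrKC m) expRD.
by rewrite ler_wpM2l ?expR_ge0 ?expR_ge1Dx.
Qed.

(* The expected number of paid edges: among x, y and their common neighbours, x
   comes first with probability 1 / (codeg g x y + 2). *)
Definition mean_paid n (g : graph n) : R :=
  \sum_x \sum_(y in g x) (codeg g x y + 2)%:R^-1.

Lemma sum_card_paid n (g : graph n) : simple_graph g ->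
  \sum_(s : 'S_n) #|paid s g|%:R = n`!%:R * mean_paid g.
Proof.
move=> sg; rewrite /mean_paid mulr_sumr.
have cE (s : 'S_n) : #|paid s g|%:R =
    \sum_x \sum_y (if (x, y) \in paid s g then 1 else 0) :> R.
  by rewrite pair_bigA -sum1_card natr_sum big_mkcond; apply: eq_bigr => -[].
under eq_bigr => s _ do rewrite cE.
rewrite exchange_big; apply: eq_bigr => x _ /=.
rewrite exchange_big mulr_sumr [RHS]big_mkcond; apply: eq_bigr => y _ /=.
case: ifP => yx; last by rewrite big1 // => s _; rewrite inE /= yx.
pose B := x |: (y |: g x :&: g y).
have cB : #|B| = (codeg g x y + 2)%N.
  rewrite /B !cardsU1 !inE (negbTE (simple_irr sg x)) (negbTE (simple_irr sg y)).
  rewrite andbF /= orbF; have -> : x != y.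
    by apply: contraTneq yx => ->; exact: simple_irr.
  by rewrite /codeg addn2 !add1n.
have := @card_perm_argmin n B x; rewrite !inE eqxx => /(_ isT) <-.
rewrite natrM cB mulfK ?pnatr_eq0 ?addn2 // -sum1_card natr_sum [RHS]big_mkcond.
by apply: eq_bigr => s _; rewrite !inE /= yx.
Qed.

(** Jensen's inequality over a uniform order bounds each term by the average of exp(-l |paid|), to
    which [sum_paid_le] applies order by order. *)
Lemma sum_expR_mean_paid_le n d (l : R) :
  \sum_(g in regular_graphs n d) expR (- l * mean_paid g)
    <= (1 + expR (- l)) ^+ (n * n) * 2 ^+ (d * d * n).
Proof.
have f0 : 0 < n`!%:R :> R by rewrite ltr0n fact_gt0.
rewrite -(ler_pM2l f0) mulr_sumr.
apply: (@le_trans _ _ (\sum_(g in regular_graphs n d)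
    \sum_(s : 'S_n) expR (- l) ^+ #|paid s g|)).
  apply: ler_sum => g /[!inE] /andP[sg _].
  have := @expR_mean_le _ (fun s : 'S_n => #|paid s g|%:R * (- l)).
  rewrite card_Sn fact_gt0 => /(_ isT); rewrite -mulr_suml sum_card_paid //.
  have -> : n`!%:R * mean_paid g * - l / n`!%:R = - l * mean_paid g.
    by field; rewrite gt_eqF.
  by under [in leRHS]eq_bigr => s _ do rewrite expRM_natl.
rewrite exchange_big /=.
apply: (@le_trans _ _ (\sum_(s : 'S_n) (1 + expR (- l)) ^+ (n * n) * 2 ^+ (d * d * n))).
  by apply: ler_sum => s _; apply: sum_paid_le; apply: expR_ge0.
by rewrite sumr_const card_Sn mulr_natl.
Qed.

(* The difference of the first two terms and the left-hand side vanishes exactly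
   for t = 0 and for t = d - 1, the codegree of the edges of a (d+1)-clique. *)
Lemma inv_codeg_le d t : (t < d)%N ->
  (t + 2)%:R^-1 <= 2^-1 - t%:R / (2 * d.+1%:R)
     - (0 < t < d.-1)%N%:R / (2 * d.+1%:R ^+ 2) :> R.
Proof.
case: d => // d; rewrite ltnS /= => td; rewrite natrD.
have t0 : 0 <= t%:R :> R by [].
have td' : t%:R <= d%:R :> R by rewrite ler_nat.
have D0 : 0 < d.+2%:R :> R by [].
have -> : d.+2%:R = d%:R + 2 :> R by rewrite -addn2 natrD.
set x : R := t%:R in t0 td' *; set D : R := d%:R in td' *.
(* For 0 < t < d both factors are at least 1; after the case split the degree is D + 1. *)
have key : (0 < t < d)%N%:R <= x * (D - x).
  case: (boolP (_ && _)) => [/andP[t1 t2]|_]; last by rewrite mulr_ge0 ?subr_ge0.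
  have x1 : 1 <= x by rewrite ler1n.
  have x2 : x + 1 <= D by rewrite /x /D natr1 ler_nat.
  by apply: mulr_ege1 => //; rewrite lerBrDl.
have b1 : (0 < t < d)%N%:R <= 1 :> R by case: (_ && _).
have b0 : 0 <= (0 < t < d)%N%:R :> R by case: (_ && _).
set b : R := (0 < t < d)%N%:R in key b1 b0 *.
rewrite -subr_ge0.
have -> : 2^-1 - x / (2 * (D + 2)) - b / (2 * (D + 2) ^+ 2) - (x + 2)^-1 =
  ((D + 2) * (x * (D - x)) - b * (x + 2)) / (2 * (D + 2) ^+ 2 * (x + 2)).
  by field; rewrite !gt_eqF //; lra.
apply: divr_ge0; last by rewrite !mulr_ge0 ?exprn_ge0 //; lra.
rewrite subr_ge0; nra.
Qed.

(** Sum [inv_codeg_le] over the dn ordered adjacent pairs: codegrees add up to 6T, and each bad node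
    starts a pair of intermediate codegree. *)
Lemma mean_paid_le n d (g : graph n) : simple_graph g -> regular d g ->
  mean_paid g <= d%:R * n%:R / 2 - 3 * #|triangles g|%:R / d.+1%:R
    - #|bad_nodes d g|%:R / (2 * d.+1%:R ^+ 2).
Proof.
move=> sg rg.
apply: (@le_trans _ _ (\sum_x \sum_(y in g x)
   (2^-1 - (codeg g x y)%:R / (2 * d.+1%:R)
     - (0 < codeg g x y < d.-1)%N%:R / (2 * d.+1%:R ^+ 2)))).
  do 2!apply: ler_sum => ? ?; apply: inv_codeg_le; exact: codeg_lt.
under eq_bigr => x _ do rewrite !sumrB -!mulr_suml sumr_const (regular_card rg).
rewrite !sumrB -!mulr_suml sumr_const card_ord.
have -> : \sum_x \sum_(y in g x) (codeg g x y)%:R = 6 * #|triangles g|%:R :> R.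
  rewrite -natrM -sum_codeg_triangles // natr_sum.
  by apply: eq_bigr => x _; rewrite natr_sum.
have bad : #|bad_nodes d g|%:R <=
   \sum_x \sum_(y in g x) (0 < codeg g x y < d.-1)%N%:R :> R.
  rewrite -sum1_card natr_sum big_mkcond; apply: ler_sum => x _.
  case: ifP => [|_]; last by apply: sumr_ge0 => y _.
  rewrite inE => /(bad_node_edge sg rg)[y yx cy].
  by rewrite (bigD1 y) //= cy lerDl sumr_ge0.
have D0 : 0 < d.+1%:R :> R by [].
apply: lerB; last by rewrite ler_wpM2r // invr_ge0 mulr_ge0 ?exprn_ge0.
rewrite -mulrnA -[_ *+ _]mulr_natl natrM; apply: lerB; first by [].
by rewrite le_eqVlt; apply/orP; left; apply/eqP; field; rewrite gt_eqF.
Qed.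

End Weights.

(** * Comparison of the two counts *)

Section Asymptotics.
Variable R : realType.
Implicit Types (d n : nat) (c e : R).

(** Stirling-type bound m! >= (m/e)^m, from the single term m^m / m! in the series of exp m. *)
Lemma expR_fact_le (m : nat) (x : R) : expR x <= m%:R ->
  expR (m%:R * (x - 1)) <= m`!%:R.
Proof.
case: m => [|m] xm; first by rewrite mul0r expR0.
rewrite mulrBr mulr1 expRB ler_pdivrMr ?expR_gt0 //.
rewrite -ler_pdivrMl ?ltr0n ?fact_gt0 // mulrC.
apply: le_trans (expR_ge1Dxn m (ler0n R m.+1)); apply: ler_wpDl => //.
rewrite ler_pM2r ?invr_gt0 ?ltr0n ?fact_gt0 // expRM_natl.
by rewrite lerXn2r // nnegrE ?expR_ge0.
Qed.

Lemma ln_le_natr n : ln n%:R <= n%:R :> R.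
Proof.
case: n => [|n]; first by rewrite ln0.
have n0 : 0 < n.+1%:R :> R by [].
rewrite -ler_expR lnK ?posrE //.
by apply: le_trans (expR_ge1Dx _); rewrite lerDr.
Qed.

(** Exponential Markov inequality: with l = ln n each counted graph contributes at least exp(-l m)
    to the sum bounded in [sum_expR_mean_paid_le]. *)
Lemma card_bad_le d c e n : (0 < n)%N ->
  #|[set g in Gdc d c n | e * n%:R < #|bad_nodes d g|%:R]|%:R <=
  expR (ln n%:R * (d%:R * n%:R / 2 - c * 'C(d, 2)%:R * n%:R / d.+1%:R
                   - e * n%:R / (2 * d.+1%:R ^+ 2))
        + (d * d).+1%:R * n%:R).
Proof.
move=> n0; set S := [set g in _ | _]; set l : R := ln n%:R.
set m := (_ - _ - _).
have nR : 0 < n%:R :> R by rewrite ltr0n.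
have l0 : 0 <= l by rewrite ln_ge0 // ler1n.
have D0 : 0 < d.+1%:R :> R by [].
have Sreg g : g \in S -> g \in regular_graphs n d.
  by rewrite !inE => /andP[/and3P[-> ->]].
have mean g : g \in S -> mean_paid R g <= m.
  rewrite !inE => /andP[/and3P[sg rg tg] bg].
  apply: le_trans (mean_paid_le R sg rg) _; rewrite /m.
  apply: lerB; last first.
    by rewrite ler_wpM2r ?(ltW bg) // invr_ge0 mulr_ge0 ?exprn_ge0.
  apply: lerB => //; rewrite ler_wpM2r ?invr_ge0 //.
  apply: le_trans (ler_wpM2l (ler0n R 3) tg); rewrite /Tmax le_eqVlt.
  by apply/orP; left; apply/eqP; field.
(* As exp(-l) = 1/n, the choice among all n^2 pairs costs only (1 + 1/n)^(n^2) <= e^n. *)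
have base : (1 + expR (- l)) ^+ (n * n) <= expR n%:R.
  apply: (@le_trans _ _ (expR n%:R^-1 ^+ (n * n))).
    rewrite lerXn2r ?nnegrE ?addr_ge0 ?expR_ge0 //.
    by rewrite expRN lnK ?posrE // expR_ge1Dx.
  by rewrite -expRM_natl natrM mulfK ?gt_eqF.
have two : 2 ^+ (d * d * n) <= expR ((d * d)%:R * n%:R) :> R.
  rewrite -natrM -[X in expR X]mulr1 expRM_natl lerXn2r ?nnegrE ?expR_ge0 //.
  exact: expR_ge1Dx.
have key : #|S|%:R * expR (- l * m) <= expR ((d * d).+1%:R * n%:R).
  rewrite -natr1 mulrDl mul1r expRD [leRHS]mulrC.
  apply: le_trans (ler_pM _ _ base two); rewrite ?exprn_ge0 ?addr_ge0 ?expR_ge0 //.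
  apply: le_trans (sum_expR_mean_paid_le n d l).
  rewrite mulr_natl -sumr_const [leRHS](bigID (mem S)) /=.
  rewrite [X in _ <= X + _](eq_bigl (fun g => g \in S)) => [|g]; last first.
    by rewrite andbC; case: (boolP (g \in S)) => [/Sreg ->|_].
  apply: ler_wpDr; first by apply: sumr_ge0 => g _; apply: expR_ge0.
  apply: ler_sum => g gS; rewrite ler_expR !mulNr lerN2.
  by rewrite ler_wpM2l // mean.
rewrite expRD -ler_pdivrMl ?expR_gt0 // -expRN -mulNr mulrC.
exact: key.
Qed.

(** Stirling on k!^d q!^(d^2): since n = k(d+1) + 2dq, the coefficient dk + d^2 q of ln n equals
    dn/2 - k C(d,2). *)
Lemma card_Gdc_ge d c n k q (a : R) : (0 < n)%N -> (0 < d)%N ->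
  (k * d.+1 + 2 * d * q)%N = n -> c * n%:R <= k%:R * d.+1%:R ->
  0 < a -> a <= 1 -> a * n%:R <= k%:R -> a * n%:R <= q%:R ->
  expR (ln n%:R * (d%:R * n%:R / 2 - k%:R * 'C(d, 2)%:R)
        - (d + d * d)%:R * (1 - ln a) * n%:R) <= #|Gdc d c n|%:R.
Proof.
move=> n0 d0 nE ck a0 a1 ak aq.
have nR : 0 < n%:R :> R by rewrite ltr0n.
have C2n : ('C(d, 2) * 2 = d * d.-1)%N by rewrite mulnC -mul_bin_diag bin1.
have C2 : 'C(d, 2)%:R * 2 = d%:R * d.-1%:R :> R by rewrite -!natrM C2n.
set l : R := ln n%:R; pose x := l + ln a.
have xE : expR x = a * n%:R by rewrite expRD !lnK ?posrE // mulrC.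
apply: (@le_trans _ _ (k`! ^ d * q`! ^ (d * d))%:R); last first.
  rewrite ler_nat; apply: leq_trans (card_regular_many_triangles nE) _.
  apply: subset_leq_card; apply/fintype.subsetP => g.
  rewrite !inE => /and3P[-> -> T] /=.
  have {}T : k%:R * d.+1%:R * d%:R * d.-1%:R <= 6 * #|triangles g|%:R :> R.
    by rewrite -!natrM ler_nat.
  rewrite /Tmax.
  have : c * n%:R * (d%:R * d.-1%:R) <= k%:R * d.+1%:R * (d%:R * d.-1%:R).
    by rewrite ler_wpM2r // mulr_ge0.
  rewrite -C2 => H.
  have -> : c * ('C(d, 2)%:R * n%:R / 3) = c * n%:R * ('C(d, 2)%:R * 2) / 6 by field.
  rewrite ler_pdivrMr //; apply: le_trans H _; rewrite C2 mulrA.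
  by rewrite [leRHS]mulrC.
rewrite natrM !natrX.
apply: (@le_trans _ _ (expR (k%:R * (x - 1)) ^+ d * expR (q%:R * (x - 1)) ^+ (d * d))).
  rewrite -!expRM_natl -expRD ler_expR.
  have kn : k%:R <= n%:R :> R by rewrite ler_nat; nia.
  have qn : q%:R <= n%:R :> R by rewrite ler_nat; nia.
  have nER : n%:R = k%:R * (d%:R + 1) + 2 * d%:R * q%:R :> R.
    by rewrite -nE natrD !natrM natr1.
  have {}C2 : 'C(d, 2)%:R = d%:R * (d%:R - 1) / 2 :> R.
    by rewrite -[in X in X - 1](prednK d0) -natr1 addrK -C2 mulfK.
  have y0 : 0 <= 1 - ln a by rewrite subr_ge0 (le_trans (ln_le0 a1)).
  have -> : d%:R * (k%:R * (x - 1)) + (d * d)%:R * (q%:R * (x - 1)) =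
    l * (d%:R * n%:R / 2 - k%:R * 'C(d, 2)%:R)
    - (d%:R * k%:R + d%:R * d%:R * q%:R) * (1 - ln a).
    by rewrite C2 nER natrM /x; field.
  rewrite lerD2l lerN2 [leRHS]mulrAC ler_wpM2r // natrD natrM mulrDl.
  by rewrite lerD // ler_wpM2l // mulr_ge0.
by rewrite ler_pM ?exprn_ge0 ?expR_ge0 // lerXn2r ?nnegrE ?expR_ge0 // expR_fact_le // xE.
Qed.

Lemma bad_proportion_le d c : (0 < d)%N -> 0 < c -> c < 1 ->
  exists C N, forall n e, (N <= n)%N -> 0 < e ->
  bad_proportion d c e n <= expR (n%:R * (C - e * ln n%:R / (2 * d.+1%:R ^+ 2))).
Proof.
move=> d0 c0 c1.
have dR : 0 < d%:R :> R by rewrite ltr0n.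
have DR : 0 < d.+1%:R :> R by [].
(* Chosen so that a n <= k, q: k >= cn/(d+1), and the cliques leave at least (1-c)n/2 vertices, so q
   >= (1-c)n/(4d). *)
pose a := Num.min (c / d.+1%:R) ((1 - c) / (4 * d%:R)).
have a0 : 0 < a by rewrite lt_min !divr_gt0 ?subr_gt0 ?mulr_gt0.
have a1 : a <= 1.
  rewrite ge_min ler_pdivrMr // mul1r (le_trans (ltW c1)) ?ler1n //.
(* For n >= M the rounding of k costs at most (2d+1)(d+1) <= (1-c)n/2 vertices. *)
pose M : R := 2 * (2 * d + 1)%:R * d.+1%:R / (1 - c).
(* The three O(n) losses: rounding k, the encoding, and the factorial bounds. *)
pose C : R := (2 * d + 1)%:R * 'C(d, 2)%:R + (d * d).+1%:R
              + (d + d * d)%:R * (1 - ln a).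
exists C, (Num.truncn M).+1 => n e Nn e0; rewrite /bad_proportion.
(* An empty class gives proportion 0 by convention; otherwise a member shows that dn is even. *)
have [->|/set0Pn[g]] := eqVneq (Gdc d c n) finset.set0.
  by rewrite cards0 invr0 mulr0 expR_ge0.
rewrite inE => /and3P[sg rg _].
have n0 : (0 < n)%N by apply: leq_trans Nn.
have nR : 0 < n%:R :> R by rewrite ltr0n.
have Mn : M <= n%:R.
  by apply: ltW; apply: lt_le_trans (truncnS_gt M) _; rewrite ler_nat.
have {}Mn : (2 * d + 1)%:R * d.+1%:R <= (1 - c) * n%:R / 2.
  move: Mn; rewrite /M ler_pdivrMr ?subr_gt0 //; lra.
pose y := c * n%:R / d.+1%:R.
have y0 : 0 <= y by rewrite divr_ge0 // mulr_ge0 // ltW.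
pose k0 := (Num.truncn y).+1.
have k0y : k0%:R <= y + 1 by rewrite /k0 -natr1 lerD2r truncn_le.
have yk0 : y <= k0%:R by apply/ltW/truncnS_gt.
have cny : c * n%:R = y * d.+1%:R by rewrite divfK ?gt_eqF.
have fit : ((k0 + 2 * d) * d.+1 <= n)%N.
  rewrite -(ler_nat R) natrM natrD.
  apply: (@le_trans _ _ ((y + 1 + (2 * d)%:R) * d.+1%:R)).
    by rewrite ler_wpM2r // lerD2r.
  rewrite -addrA mulrDl -cny [1 + _]addrC natr1 -addn1.
  apply: le_trans (lerD (lexx _) Mn) _.
  have : 0 <= (1 - c) * n%:R by rewrite mulr_ge0 // subr_ge0 ltW.
  lra.
have [k [q [k0k kk0 nE]]] := clique_bipartite_decomposition d0 (regular_even sg rg) fit.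
have yk : y <= k%:R by apply: le_trans yk0 _; rewrite ler_nat.
have ky : k%:R <= y + (2 * d + 1)%:R.
  apply: (@le_trans _ _ (k0 + 2 * d)%:R); first by rewrite ler_nat.
  by rewrite !natrD; move: k0y; lra.
have ck : c * n%:R <= k%:R * d.+1%:R by rewrite cny ler_wpM2r.
have ak : a * n%:R <= k%:R.
  apply: le_trans yk; rewrite /y mulrAC ler_wpM2r //.
  by rewrite ge_min lexx.
have aq : a * n%:R <= q%:R.
  apply: (@le_trans _ _ ((1 - c) / (4 * d%:R) * n%:R)).
    by rewrite ler_wpM2r // ge_min lexx orbT.
  have nER : n%:R = k%:R * d.+1%:R + 2 * d%:R * q%:R :> R.
    by rewrite -nE natrD !natrM.
  have : k%:R * d.+1%:R <= c * n%:R + (1 - c) * n%:R / 2.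
    apply: le_trans (ler_wpM2r (ltW DR) ky) _.
    by rewrite mulrDl -cny lerD2l.
  move=> H; rewrite mulrAC ler_pdivrMr ?mulr_gt0 //; move: nER H; lra.
have up := card_bad_le d c e n0.
have low := card_Gdc_ge n0 d0 nE ck a0 a1 ak aq.
have G0 : 0 < #|Gdc d c n|%:R :> R by apply: lt_le_trans low; apply: expR_gt0.
rewrite ler_pdivrMr //; apply: le_trans up _.
apply: le_trans (ler_wpM2l (expR_ge0 _) low); rewrite -expRD ler_expR.
have l0 : 0 <= ln n%:R :> R by rewrite ln_ge0 // ler1n.
have ln_ := ln_le_natr n.
set l : R := ln n%:R in l0 ln_ *; rewrite /C.
have yE : c * 'C(d, 2)%:R * n%:R / d.+1%:R = y * 'C(d, 2)%:R.
  by rewrite /y; field.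
rewrite yE.
have B0 : 0 <= 'C(d, 2)%:R :> R by [].
(* The main terms in ln n cancel up to this rounding error, O(n) because k - y <= 2d + 1 and ln n <=
   n. *)
have Ky : l * (k%:R - y) * 'C(d, 2)%:R <= n%:R * (2 * d + 1)%:R * 'C(d, 2)%:R.
  rewrite ler_wpM2r // ler_pM ?subr_ge0 //; move: ky; lra.
rewrite -subr_ge0.
apply: le_trans (_ : 0 <= n%:R * (2 * d + 1)%:R * 'C(d, 2)%:R
  - l * (k%:R - y) * 'C(d, 2)%:R) _.
  by rewrite subr_ge0.
rewrite le_eqVlt; apply/orP; left; apply/eqP; field.
by rewrite gt_eqF.
Qed.

(** The construction needs d > 0; in degree 0 there are no edges, hence no bad nodes. *)
Lemma bad_proportion_degree0 c e n : 0 < e -> bad_proportion 0 c e n = 0.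
Proof.
move=> e0; rewrite /bad_proportion (_ : [set g in _ | _] = finset.set0).
  by rewrite cards0 mul0r.
apply/setP => g; rewrite !inE; apply/negP => /andP[/and3P[sg rg _]].
rewrite (_ : bad_nodes 0 g = finset.set0).
  by rewrite cards0 ltNge mulr_ge0 // ltW.
apply/setP => x; rewrite !inE; apply/negP => /(bad_node_edge sg rg)[y _].
by rewrite ltn0 andbF.
Qed.

End Asymptotics.

(** * Passage to the limit *)

Import numFieldNormedType.Exports.
Local Open Scope classical_set_scope.

Theorem theorem5 (R : realType) (d : nat) (c : R) (eps : nat -> R) :
  0 < c -> c < 1 ->
  (forall n, 0 < eps n) ->
  ((exists e : R, forall n, eps n = e) \/
   (eps @ \oo --> 0 /\ (fun n => eps n * ln n%:R) @ \oo --> +oo)) ->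
  (fun n => bad_proportion d c (eps n) n) @ \oo --> 0.
Proof.
move=> c0 c1 eps0 heps.
(* In both regimes eps_n ln n tends to infinity; for a constant e, take n >= exp(A / e). *)
have big (A : R) : \forall n \near \oo, A <= eps n * ln n%:R.
  case: heps => [[e eE]|[_ /cvgryPge]]; last exact.
  have e0 : 0 < e by rewrite -(eE 0%N).
  near=> n; rewrite eE -ler_pdivrMl //.
  rewrite -ler_expR lnK; last by rewrite posrE ltr0n; near: n; exact: nbhs_infty_gt.
  near: n; exact: nbhs_infty_ger.
have [->|d0] := posnP d.
  by apply: cvg_near_cst; near=> n; apply: bad_proportion_degree0.
have [C [N le]] := bad_proportion_le d0 c0 c1.
have D0 : 0 < 2 * d.+1%:R ^+ 2 :> R by rewrite mulr_gt0 ?exprn_gt0.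
(* Once eps_n ln n >= 2(d+1)^2 (C+1), the exponent is at most -n. *)
apply: (@squeeze_cvgr _ _ _ _ (fun=> 0) (fun n => expR (1 *- n))).
- near=> n; apply/andP; split; first by rewrite /bad_proportion divr_ge0.
  apply: (le_trans (le _ _ _ (eps0 n))); first by near: n; exact: nbhs_infty_ge.
  rewrite ler_expR -[leRHS]mulrN1 ler_wpM2l //.
  rewrite lerBlDr -lerBlDl opprK ler_pdivlMr //.
  near: n; exact: big.
- exact: cvg_cst.
- exact: cvgn_expR.
Unshelve. all: by end_near.
Qed.
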